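(* A graph $G$ is a half-square of a star biconvex bipartite graph (i.e., there is a star biconvex bipartite graph $B=(V(G),W,E_B)$ with $G=B^2[V(G)]$) if and only if $G$ has at most one big connected component and the big connected component is obtained from a split graph having a universal vertex by substituting vertices by cliques.
   Context: For a bipartite graph $B=(X,Y,E_B)$, the half-square $B^2[X]$ is the graph on $X$ where two distinct vertices are adjacent iff they have a common neighbor in $Y$. $B$ is star biconvex if there is a star $T_1$ on vertex set $X$ such that for each $y\in Y$, $N(y)$ induces a subtree of $T_1$, and there is a star $T_2$ on vertex set $Y$ such that for each $x\in X$, $N(x)$ induces a subtree of $T_2$. A connected component is big if it has at least two vertices; a universal vertex is adjacent to all other vertices of the graph. A split graph is a graph whose vertex set can be partitioned into a clique and a stable set. Substituting a vertex $v$ of $G$ by a graph $H$ yields the graph obtained from $G-v$ and $H$ by adding all edges between $N_G(v)$ and $V(H)$; ''substituting vertices by cliques'' means substituting some vertices, each by a nonempty complete graph. *)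

(* Defs.v *)
From mathcomp Require Import all_boot.
Set Implicit Arguments.
Unset Strict Implicit.
Unset Printing Implicit Defensive.

Record sgraph (V : finType) := SGraph {
  adj :> rel V;
  adj_sym : symmetric adj;
  adj_irr : irreflexive adj }.

Section Graphs.
Variable V : finType.
Implicit Types (G : sgraph V) (A C K : {set V}).

Definition induced_adj G A : rel {x | x \in A} :=
  fun x y => G (val x) (val y).

Lemma induced_sym G A : symmetric (@induced_adj G A).
Proof. by move=> x y; rewrite /induced_adj adj_sym. Qed.

Lemma induced_irr G A : irreflexive (@induced_adj G A).
Proof. by move=> x; rewrite /induced_adj adj_irr. Qed.

Definition induced G A : sgraph {x | x \in A} :=
  SGraph (@induced_sym G A) (@induced_irr G A).

Definition complete_adj : rel V := fun x y => x != y.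

Lemma complete_sym : symmetric complete_adj.
Proof. by move=> x y; rewrite /complete_adj eq_sym. Qed.

Lemma complete_irr : irreflexive complete_adj.
Proof. by move=> x; rewrite /complete_adj eqxx. Qed.

Definition complete : sgraph V := SGraph complete_sym complete_irr.

Definition connected G := 0 < #|V| /\ forall x y : V, connect G x y.

(* A one-element [ucycle] is excluded by irreflexivity, and a two-element one
   is just an edge traversed back and forth. *)
Definition acyclic G := forall c : seq V, ucycle G c -> size c <= 2.

Definition is_tree G := connected G /\ acyclic G.

Definition universal G (u : V) := forall x, x != u -> G u x.

(* The one-vertex graph K_{1,0} counts as a star. *)
Definition is_star G := is_tree G /\ exists c : V, universal G c.

Definition clique G K := {in K &, forall x y, x != y -> G x y}.

Definition stable G K := {in K &, forall x y, ~~ G x y}.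

Definition is_split G := exists K : {set V}, clique G K /\ stable G (~: K).

Definition component G C := exists x : V, C = [set y | connect G x y].

Definition big_component G C := component G C /\ 2 <= #|C|.

End Graphs.

Definition induces_subtree (V : finType) (T : sgraph V) (A : {set V}) :=
  is_tree (induced T A).

(* A bipartite graph (X, Y, E) is given by its edge set E as a boolean relation
   between X and Y. *)
Section Bipartite.
Variables (X Y : finType) (E : X -> Y -> bool).

Definition nbhX (x : X) : {set Y} := [set y | E x y].
Definition nbhY (y : Y) : {set X} := [set x | E x y].

Definition star_biconvex :=
  (exists T1 : sgraph X,
     is_star T1 /\ forall y : Y, induces_subtree T1 (nbhY y)) /\
  (exists T2 : sgraph Y,
     is_star T2 /\ forall x : X, induces_subtree T2 (nbhX x)).

Definition half_square_adj : rel X :=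
  fun x x' => (x != x') && [exists y, E x y && E x' y].

Lemma half_square_sym : symmetric half_square_adj.
Proof.
move=> x x'; rewrite /half_square_adj eq_sym; congr (_ && _).
by apply: eq_existsb => y; rewrite andbC.
Qed.

Lemma half_square_irr : irreflexive half_square_adj.
Proof. by move=> x; rewrite /half_square_adj eqxx. Qed.

Definition half_square : sgraph X := SGraph half_square_sym half_square_irr.

End Bipartite.

Definition iso (V W : finType) (G : sgraph V) (H : sgraph W) :=
  exists f : V -> W, bijective f /\ forall x y, H (f x) (f y) = G x y.

Section Substitution.
Variables (V W : finType) (G : sgraph V) (v : V) (H : sgraph W).

(* [inl] embeds the vertices of G - v and [inr] those of H. *)
Definition subst_adj : rel ({x : V | x != v} + W)%type := fun a b =>
  match a, b with
  | inl x, inl y => G (val x) (val y)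
  | inl x, inr _ => G v (val x)
  | inr _, inl y => G v (val y)
  | inr s, inr t => H s t
  end.

Lemma subst_sym : symmetric subst_adj.
Proof. by move=> [x|s] [y|t] //=; rewrite adj_sym. Qed.

Lemma subst_irr : irreflexive subst_adj.
Proof. by move=> [x|s] /=; rewrite adj_irr. Qed.

Definition substitute : sgraph ({x : V | x != v} + W)%type :=
  SGraph subst_sym subst_irr.

Definition remaining (A : {set V}) : {set ({x : V | x != v} + W)%type} :=
  [set a | if a is inl x then val x \in A else false].

End Substitution.

(* [clique_subst H A G]: up to isomorphism, H is obtained from G by successively
   substituting some of the vertices in A, each at most once, by nonempty
   complete graphs.  After a substitution only the original vertices of A other
   than v may still be substituted, not those of the inserted clique. *)
Inductive clique_subst (U : finType) (H : sgraph U) :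
    forall V : finType, {set V} -> sgraph V -> Prop :=
| clique_subst_done (V : finType) (A : {set V}) (G : sgraph V) :
    iso G H -> clique_subst H A G
| clique_subst_step (V : finType) (A : {set V}) (G : sgraph V)
    (v : V) (K : finType) :
    v \in A -> 0 < #|K| ->
    clique_subst H (remaining K v A) (substitute G v (complete K)) ->
    clique_subst H A G.

Definition obtained_by_clique_substitution
    (U V : finType) (H : sgraph U) (G : sgraph V) :=
  clique_subst H [set: V] G.

(* Main.v *)
Require Import Defs.
From mathcomp Require Import all_boot.

Set Implicit Arguments.
Unset Strict Implicit.
Unset Printing Implicit Defensive.

(** Both sides are equivalent to a condition on [G] alone ([clique_core]): there
    are a clique [P] and a vertex [c] of [P] adjacent to every other non-isolated
    vertex, such that adjacent vertices outside [P] are true twins.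
    - In a star a subtree is a singleton or contains the center, so given a star
      biconvex [B] with centers [c] and [w] one takes [P := N(w)] if [w] is a
      neighbor of [c], and otherwise [P := N(a)] with [a] the only neighbor of
      [c].  Conversely, [G] is the half-square of the bipartite graph having one
      vertex for [P] and one for each closed neighborhood of a vertex outside [P].
    - Graphs obtained from [S] by clique substitutions are those with a surjection
      onto [S] whose fibers are cliques of true twins; on the big component the
      split graph is the quotient by true twinship. *)

(** * Stars and their subtrees *)

Section StarGraph.
Variables (V : finType) (c : V).

Definition star_adj : rel V := fun x y => (x != y) && ((x == c) || (y == c)).

Lemma star_adj_sym : symmetric star_adj.
Proof. by move=> x y; rewrite /star_adj eq_sym orbC. Qed.

Lemma star_adj_irr : irreflexive star_adj.
Proof. by move=> x; rewrite /star_adj eqxx. Qed.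

Definition star : sgraph V := SGraph star_adj_sym star_adj_irr.

End StarGraph.

Section Trees.
Variables (V : finType) (T : sgraph V).

Lemma universal_connected c : universal T c -> connected T.
Proof.
move=> cT; split; first by apply/card_gt0P; exists c.
have cx x : connect T c x.
  by have [->|xc] := eqVneq x c; rewrite ?connect0 // connect1 ?cT.
have symT : connect_sym T by apply: sym_connect_sym => x y; rewrite adj_sym.
by move=> x y; apply: connect_trans (cx y); rewrite symT.
Qed.

(** In a cycle of length at least 3 every vertex misses some edge, so [c] cannot meet all of
    them. *)
Lemma acyclic_of_center c :
  (forall x y, T x y -> (x == c) || (y == c)) -> acyclic T.
Proof.
move=> Tc [|x [|y [|z s]]] //= /andP[/= /and3P[/Tc xy /Tc yz cyc]].
rewrite !inE !negb_or => /and3P[/and3P[nxy nxz _] /andP[nyz nys] _].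
have [ex|nxc] := eqVneq x c.
  by case/orP: yz => /eqP e; rewrite ex e eqxx in nxy nxz.
rewrite (negPf nxc) /= in xy; move/eqP: xy => ey.
case: s nys cyc => [|t s] nys /= /andP[/Tc zt _].
  by move: zt; rewrite (negPf nxc) orbF -ey eq_sym (negPf nyz).
move: nys; rewrite inE negb_or => /andP[nyt _].
by move: zt; rewrite -ey !(eq_sym _ y) (negPf nyz) (negPf nyt).
Qed.

Lemma tree_of_center c :
  universal T c -> (forall x y, T x y -> (x == c) || (y == c)) -> is_tree T.
Proof.
move=> cT Tc; split; [exact: universal_connected cT | exact: acyclic_of_center Tc].
Qed.

(** Otherwise [c], [x], [y] would form a triangle. *)
Lemma acyclic_edge_center c x y :
  acyclic T -> universal T c -> T x y -> (x == c) || (y == c).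
Proof.
move=> aT cT xy; apply/negPn/negP; rewrite negb_or => /andP[xc yc].
have nxy : x != y by apply: contraTneq xy => ->; rewrite adj_irr.
have /aT// : ucycle T [:: c; x; y].
apply/andP; split; last by rewrite /= !inE negb_or eq_sym xc eq_sym yc nxy.
by rewrite /= cT // xy adj_sym cT.
Qed.

(** Every edge of a star meets its center, so a set missing the center induces no edge and is
    connected only as a singleton. *)
Lemma star_subtree c (A : {set V}) :
    is_star T -> universal T c -> induces_subtree T A ->
  c \in A \/ exists x, A = [set x].
Proof.
move=> [[_ aT] _] cT [[/card_gt0P[x0 _] conA] _].
have [cA|cA] := boolP (c \in A); [by left | right].
exists (val x0); apply/setP=> y; rewrite inE.
apply/idP/eqP => [yA|->]; last exact: valP.
case/connectP: (conA x0 (exist _ y yA)) => -[_ /(congr1 val)//|z p /=].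
case/andP=> x0z _ _.
by case/orP: (acyclic_edge_center aT cT x0z) => /eqP e; case/negP: cA;
  rewrite -e; apply: valP.
Qed.

End Trees.

Section Stars.
Variables (V : finType) (c : V).

Lemma universal_star : universal (star c) c.
Proof. by move=> x xc; rewrite /= /star_adj eq_sym xc eqxx. Qed.

Lemma star_is_star : is_star (star c).
Proof.
split; last by exists c; apply: universal_star.
by apply: tree_of_center universal_star _ => x y /andP[].
Qed.

Lemma star_subtree_center (A : {set V}) :
  c \in A -> induces_subtree (star c) A.
Proof.
move=> cA; apply: (@tree_of_center _ _ (exist _ c cA)) => [x xc|x y /andP[_]].
  by apply: universal_star; rewrite -val_eqE in xc.
by rewrite -!val_eqE.
Qed.

Lemma star_subtree1 (x : V) : induces_subtree (star c) [set x].
Proof.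
have xx : x \in [set x] by rewrite inE.
have all_x (z : {z | z \in [set x]}) : z = exist _ x xx.
  by apply: val_inj => /=; apply/set1P/(valP z).
apply: (@tree_of_center _ _ (exist _ x xx)) => [z|y z _].
  by rewrite (all_x z) eqxx.
by rewrite (all_x y) eqxx.
Qed.

End Stars.

(** * Half-squares of star biconvex graphs and clique cores *)

Section CliqueCore.
Variables (V : finType) (G : sgraph V).

(** Closed neighborhood, in terms of which true twinship is an equation. *)
Definition clnbh (x : V) : {set V} := [set y | (y == x) || G x y].

Lemma in_clnbh x y : (y \in clnbh x) = (y == x) || G x y.
Proof. by rewrite inE. Qed.

Lemma clnbh_refl x : x \in clnbh x.
Proof. by rewrite in_clnbh eqxx. Qed.

Lemma clnbh_sym x y : (y \in clnbh x) = (x \in clnbh y).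
Proof. by rewrite !in_clnbh eq_sym adj_sym. Qed.

Lemma adj_clnbh x y : G x y = (x != y) && (y \in clnbh x).
Proof.
rewrite in_clnbh eq_sym; have [->|//] := eqVneq y x; exact: adj_irr.
Qed.

Definition clique_core (P : {set V}) (c : V) :=
  [/\ clique G P, c \in P, (forall x y, G x y -> x \in clnbh c) &
      forall x y, x \notin P -> y \notin P -> G x y -> clnbh x = clnbh y].

Section HalfSquareOfCore.
Variables (P : {set V}) (c : V) (Pc : clique_core P c).

Definition outer_clnbh (A : {set V}) := [exists y, (y \notin P) && (A == clnbh y)].

(* Indices [A] that are not closed neighborhoods of outer vertices are attached
   to [c] alone: every vertex of the bipartite graph must have a neighbor. *)
Definition core_edge (x : V) (a : option {set V}) : bool :=
  if a is Some A then if outer_clnbh A then x \in A else x == c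
  else x \in P.

(** In the star at [c], closed neighborhoods of non-isolated vertices contain [c], the others are
    singletons. In the star at [None], a vertex of [P] sees the center, and a vertex outside [P] has
    one neighbor only: all outer closed neighborhoods containing it coincide. *)
Lemma core_star_biconvex : star_biconvex core_edge.
Proof.
case: Pc => Pcl cP dom twin; split.
  exists (star c); split=> [|[A|]]; first exact: star_is_star.
    have [/existsP[y /andP[yP /eqP eA]]|nA] := boolP (outer_clnbh A); last first.
      suff -> : nbhY core_edge (Some A) = [set c] by exact: star_subtree1.
      by apply/setP=> x; rewrite !inE /= (negPf nA).
    have -> : nbhY core_edge (Some A) = clnbh y.
      apply/setP=> x; rewrite [LHS]inE /= ifT ?eA //.
      by apply/existsP; exists y; rewrite yP eqxx.
    have [/existsP[z yz]|iso_y] := boolP [exists z, G y z].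
      by apply: star_subtree_center; rewrite clnbh_sym (dom y z).
    suff -> : clnbh y = [set y] by exact: star_subtree1.
    apply/setP=> z; rewrite in_clnbh inE; have [//|_] := eqVneq z y.
    by apply: contraNF iso_y => yz; apply/existsP; exists z.
  by apply: star_subtree_center; rewrite inE.
exists (star None); split=> [|x]; first exact: star_is_star.
have [xP|xP] := boolP (x \in P); first by apply: star_subtree_center; rewrite inE.
suff -> : nbhX core_edge x = [set Some (clnbh x)] by exact: star_subtree1.
apply/setP=> -[A|]; rewrite !inE /=; last exact: negPf.
case: ifP => [/existsP[y /andP[yP /eqP->]]|nA].
  apply/idP/eqP => [|[->]]; last exact: clnbh_refl.
  by rewrite in_clnbh => /orP[/eqP->//|yx]; rewrite (twin y x).
(* Here [A] is attached to [c] alone, and [c] lies in [P], unlike [x]. *)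
transitivity false; first by apply: contraNF xP => /eqP->.
apply/esym/negP => /eqP[eA]; case/negP: (negbT nA).
by apply/existsP; exists x; rewrite xP eA eqxx.
Qed.

(** An edge inside [P] is witnessed by [None], any other edge by the closed neighborhood of an end
    outside [P]. *)
Lemma core_half_square x y : G x y = half_square core_edge x y.
Proof.
case: Pc => Pcl cP dom twin; rewrite /= /half_square_adj.
have [->|nxy] /= := eqVneq x y; first exact: adj_irr.
apply/idP/existsP => [xy|[[A|] /= /andP[]]]; last by move=> ? ?; apply: Pcl.
  have outer z : z \notin P -> outer_clnbh (clnbh z).
    by move=> zP; apply/existsP; exists z; rewrite zP eqxx.
  have [xP|xP] := boolP (x \in P); last first.
    by exists (Some (clnbh x)); rewrite /= outer // clnbh_refl in_clnbh xy orbT.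
  have [yP|yP] := boolP (y \in P); first by exists None; rewrite /= xP.
  exists (Some (clnbh y)).
  by rewrite /= outer // clnbh_refl in_clnbh adj_sym xy orbT.
case: ifP => [/existsP[z /andP[zP /eqP->]]|_ /eqP ex /eqP ey]; last first.
  by rewrite ex ey eqxx in nxy.
(* Outside [P], [u] is [z] or a true twin of [z], so [v] is in its closed neighborhood as well. *)
have far u v : u \notin P -> u \in clnbh z -> v \in clnbh z -> u != v -> G u v.
  move=> uP uz vz nuv; rewrite adj_clnbh nuv /=.
  suff -> : clnbh u = clnbh z by [].
  by move: uz; rewrite in_clnbh => /orP[/eqP->//|zu]; rewrite -(twin z u).
move=> xz yz; have [xP|xP] := boolP (x \in P); last exact: far.
have [yP|yP] := boolP (y \in P); first exact: Pcl.
by rewrite adj_sym far // eq_sym.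
Qed.

End HalfSquareOfCore.

Lemma half_square_core (W : finType) (E : V -> W -> bool) :
    star_biconvex E -> (forall x y, G x y = half_square E x y) ->
  exists P c, clique_core P c.
Proof.
move=> [[T1 [sT1 subY]] [T2 [sT2 subX]]] GE.
have [_ [c cT1]] := sT1; have [_ [w wT2]] := sT2.
have GP x y : reflect (x != y /\ exists a, E x a && E y a) (G x y).
  by rewrite GE; apply: (iffP andP) => -[? /existsP].
(* Two distinct neighbors of [a] exclude a singleton, so the subtree contains the center. *)
have hY a x y : E x a -> E y a -> x != y -> E c a.
  move=> xa ya nxy; case: (star_subtree sT1 cT1 (subY a)); rewrite ?inE //.
  case=> z /setP ez; have:= ez x; have:= ez y; rewrite !inE xa ya.
  by do 2!move/esym/eqP=> ?; case/eqP: nxy; congruence.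
have hX x : ~~ E x w -> exists a, forall b, E x b = (b == a).
  move=> xw; case: (star_subtree sT2 wT2 (subX x)); rewrite ?inE ?(negPf xw) //.
  by case=> a /setP ea; exists a => b; have:= ea b; rewrite !inE.
have cl a : clique G (nbhY E a).
  move=> x y; rewrite !inE => xa ya nxy; apply/GP; split=> //.
  by exists a; rewrite xa.
have dom x y : G x y -> exists2 a, E c a & E x a.
  by case/GP=> nxy [a /andP[xa ya]]; exists a => //; apply: hY xa ya nxy.
have dom_clnbh x y : G x y -> x \in clnbh c.
  case/dom=> a ca xa; rewrite in_clnbh; have [//|nxc] := eqVneq x c.
  by apply/GP; rewrite eq_sym; split=> //; exists a; rewrite ca.
have [cw|cw] := boolP (E c w).
  exists (nbhY E w), c; split=> //; first by rewrite inE.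
  move=> x y; rewrite !inE => /hX[a xa] /hX[b yb] /GP[_ [d]].
  rewrite xa yb => /andP[/eqP da /eqP db]; subst a b.
  (* With [d] as only neighbor, [u] and [v] both have the neighborhood of [d] as closed
     neighborhood. *)
  have sub u v : (forall b, E u b = (b == d)) -> (forall b, E v b = (b == d)) ->
      clnbh u \subset clnbh v.
    move=> ud vd; apply/subsetP=> z; rewrite !in_clnbh.
    have [//|nzv] := eqVneq z v => /predU1P[ez|/GP[_ [b ub]]]; apply/GP.
      by rewrite eq_sym; split=> //; exists d; rewrite ez ud vd eqxx.
    move: ub; rewrite ud => /andP[/eqP-> zd]; rewrite eq_sym; split=> //.
    by exists d; rewrite vd eqxx.
  by apply/eqP; rewrite eqEsubset !sub.
have [a ca] := hX c cw; exists (nbhY E a), c; split=> //.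
  by rewrite inE ca.
(* A non-isolated vertex shares a neighbor with [c], which can only be [a]; so vertices outside [P]
   are isolated and the twin condition is vacuous. *)
move=> x y; rewrite inE => xa _ /dom[b]; rewrite ca => /eqP->.
by rewrite (negPf xa).
Qed.

End CliqueCore.

(** * Clique substitutions as maps with twin fibers *)

Section Blowup.

Definition blowup (U V : finType) (H : sgraph U) (G : sgraph V) (f : U -> V) :=
  forall x y, H x y = (x != y) && ((f x == f y) || G (f x) (f y)).

Variables (U : finType) (H : sgraph U).

(** Induction on [#|A|]: some [v] in [A] is substituted by its own fiber, on which the new map [h]
    is the identity. The last hypothesis says that only vertices of [A] are blown up; for empty [A]
    it makes [f] an isomorphism. *)
Lemma blowup_clique_subst (V : finType) (A : {set V}) (G : sgraph V) (f : U -> V) :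
    (forall v, exists u, f u = v) -> blowup H G f ->
    (forall x y, f x = f y -> f x \notin A -> x = y) ->
  clique_subst H A G.
Proof.
move: {2}_.+1 (ltnSn #|A|) => n; elim: n V A G f => // n IHn V A G f.
rewrite ltnS => leAn f_surj HG f_inj.
have [A0|[v vA]] := set_0Vmem A.
  apply: clique_subst_done.
  have injf : injective f by move=> x y /f_inj; apply; rewrite A0 inE.
  have [g gK] : exists g : V -> U, cancel g f.
    have ex v : exists u, f u == v by have [u <-] := f_surj v; exists u.
    by exists (fun v => xchoose (ex v)) => v; apply/eqP/(xchooseP (ex v)).
  have fK : cancel f g by move=> u; apply: injf; rewrite gK.
  exists g; split; first by exists f.
  move=> x y; rewrite HG !gK (can_eq gK).
  by have [->|] //= := eqVneq x y; rewrite adj_irr.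
pose K : finType := {u | f u == v}.
apply: (@clique_subst_step _ _ _ _ _ v K) => //.
  have [u fu] := f_surj v; apply/card_gt0P.
  by exists (exist (fun u => f u == v) u (introT eqP fu)).
pose h u : {x : V | x != v} + K :=
  match boolP (f u == v) with
  | AltTrue e => inr (exist _ u e)
  | AltFalse e => inl (exist _ (f u) e)
  end.
have hr u (e : f u == v) : h u = inr (exist _ u e).
  rewrite /h; case: {-}_ / boolP => e'; last by case/negP: (e').
  by congr inr; apply: val_inj.
have hl u (e : f u != v) : h u = inl (exist _ (f u) e).
  rewrite /h; case: {-}_ / boolP => e'; first by case/negP: (e).
  by congr inl; apply: val_inj.
apply: (IHn _ _ _ h).
(* The measure drops because [p] maps the remaining vertices injectively into [A] without [v]. *)
- pose p (a : {x : V | x != v} + K) := if a is inl x then val x else v.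
  rewrite -(card_in_imset (f := p)) => [|[x|k] [y|l]]; rewrite ?inE //=; last first.
    by move=> _ _ /val_inj->.
  apply: leq_trans leAn; apply/proper_card/properP; split.
    by apply/subsetP=> _ /imsetP[[x|k] xA ->]; rewrite inE in xA.
  exists v => //; apply/imsetP=> -[[x|k]]; rewrite inE //= => _ e.
  by have:= valP x; rewrite /= -e eqxx.
- case=> [[x xv]|[u e]]; last by exists u; rewrite hr.
  have [u fu] := f_surj x; have e : f u != v by rewrite fu.
  by exists u; rewrite hl; congr inl; apply: val_inj.
- move=> x y; rewrite HG; have [->//|nxy] /= := eqVneq x y.
  have [ex|ex] := boolP (f x == v); have [ey|ey] := boolP (f y == v).
  + rewrite (hr _ ex) (hr _ ey) /= (eqP ex) (eqP ey) eqxx /complete_adj.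
    by rewrite -val_eqE /= nxy orbT.
  + by rewrite (hr _ ex) (hl _ ey) /= (eqP ex) eq_sym (negPf ey).
  + by rewrite (hl _ ex) (hr _ ey) /= (eqP ey) (negPf ex) adj_sym.
  + by rewrite (hl _ ex) (hl _ ey).
- move=> x y; have [ex|ex] := boolP (f x == v); have [ey|ey] := boolP (f y == v).
  + by rewrite (hr _ ex) (hr _ ey) => -[].
  + by rewrite (hr _ ex) (hl _ ey).
  + by rewrite (hl _ ex) (hr _ ey).
  + by rewrite (hl _ ex) (hl _ ey) => -[exy]; rewrite inE /=; apply: f_inj.
Qed.

(** Each substitution composes the map with the projection collapsing the inserted clique to [v]; it
    stays surjective because the clique is nonempty. *)
Lemma clique_subst_blowup (V : finType) (A : {set V}) (G : sgraph V) :
    clique_subst H A G ->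
  exists2 f : U -> V, forall v, exists u, f u = v & blowup H G f.
Proof.
elim=> {V A G} [V A G [g [[f gK fK] HG]]|V A G v K vA K0 _ [f f_surj Hf]].
  exists f => [v|x y]; first by exists (g v).
  rewrite -HG !fK (can_eq fK); have [->|] //= := eqVneq x y; exact: adj_irr.
pose p (a : {x : V | x != v} + K) := if a is inl x then val x else v.
exists (p \o f) => [x|x y /=].
  have [->|xv] := eqVneq x v.
    have /card_gt0P[k _] := K0; have [u fu] := f_surj (inr k).
    by exists u; rewrite /= fu.
  by have [u fu] := f_surj (inl (exist _ x xv)); exists u; rewrite /= fu.
rewrite Hf; congr (_ && _); case: (f x) (f y) => [a|k] [b|l] //=.
- by rewrite (negPf (valP a)) adj_sym.
- by rewrite eq_sym (negPf (valP b)).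
- by rewrite eqxx /complete_adj; exact: orbN.
Qed.

End Blowup.

(** * The big component and its quotient by true twinship *)

Section CoreStructure.
Variables (V : finType) (G : sgraph V).

Lemma connect_adj_sym : connect_sym G.
Proof. by apply: sym_connect_sym => x y; rewrite adj_sym. Qed.

Lemma adj_big_component x y : G x y -> big_component G [set z | connect G x z].
Proof.
move=> xy; split; first by exists x.
have nxy : x != y by apply: contraTneq xy => ->; rewrite adj_irr.
rewrite (cardsD1 x) inE connect0 (cardsD1 y) !inE eq_sym nxy connect1 //.
Qed.

(** A vertex of a big component has a neighbor, hence equals [c] or is adjacent to it. *)
Lemma core_big_component P c C :
  clique_core G P c -> big_component G C -> C = [set z | connect G c z].
Proof.
case=> _ _ dom _ [[x ->] /card_gt1P[y [z [yC zC nyz]]]].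
suff cx : connect G c x.
  apply/setP=> t; rewrite !inE; apply: same_connect; first exact: connect_adj_sym.
  by rewrite connect_adj_sym.
have [t xt] : exists t, G x t.
  have [u nux] : exists2 u, u != x & connect G x u.
    rewrite !inE in yC zC; have [ey|] := eqVneq y x; last by exists y.
    by exists z; rewrite // -ey eq_sym.
  case/connectP=> [[|t p] /=]; first by move=> _ e; rewrite e eqxx in nux.
  by case/andP=> xt _ _; exists t.
by have:= dom x t xt; rewrite in_clnbh => /predU1P[->//|]; apply: connect1.
Qed.

Lemma core_connect P c x :
  clique_core G P c -> connect G c x -> x \in clnbh G c.
Proof.
case=> _ _ dom _; rewrite connect_adj_sym => /connectP[[_ ->|y p /= /andP[/dom//]]].
by rewrite clnbh_refl.
Qed.

(** [pick] sees [x] only through its closed neighborhood, so true twins get the same representative.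
    The default is never reached, as [x] itself qualifies. *)
Definition twin_repr (x : V) : V := odflt x [pick y | clnbh G y == clnbh G x].

Lemma clnbh_twin_repr x : clnbh G (twin_repr x) = clnbh G x.
Proof. by rewrite /twin_repr; case: pickP => [y /eqP|]. Qed.

Lemma twin_repr_eq x y : clnbh G x = clnbh G y -> twin_repr x = twin_repr y.
Proof.
rewrite /twin_repr => ->; case: pickP => [//|/(_ y)]; by rewrite eqxx.
Qed.

Lemma adj_twin_repr x y :
  G x y = (x != y) && ((twin_repr x == twin_repr y) || G (twin_repr x) (twin_repr y)).
Proof.
rewrite adj_clnbh; congr (_ && _).
by rewrite [twin_repr x == _]eq_sym -in_clnbh clnbh_twin_repr [RHS]clnbh_sym
  clnbh_twin_repr clnbh_sym.
Qed.

(** Among the representatives, those in [P] form a clique, adjacent ones outside [P] would be true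
    twins and hence equal, and the representative of [c] is universal. *)
Lemma core_split_component P c :
    clique_core G P c ->
  exists (U : finType) (S : sgraph U),
    is_split S /\ (exists u : U, universal S u) /\
    obtained_by_clique_substitution (induced G [set z | connect G c z]) S.
Proof.
move=> Pc; have [Pcl cP dom twin] := Pc.
set C := [set z | connect G c z].
pose R : {set V} := twin_repr @: C.
exists {x | x \in R}, (induced G R).
have rR (x : {x | x \in C}) : twin_repr (val x) \in R by apply/imset_f/valP.
pose f x : {x | x \in R} := exist _ (twin_repr (val x)) (rR x).
have f_surj v : exists u, f u = v.
  case: v => v vR; have /imsetP[x xC ev] := vR.
  by exists (exist _ x xC); apply: val_inj.
have repr_id z : z \in R -> twin_repr z = z.
  by case/imsetP=> x _ ->; apply/twin_repr_eq/clnbh_twin_repr.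
split; last split.
- exists [set z | val z \in P]; split=> x y; rewrite !inE => xP yP.
    by rewrite -val_eqE; apply: Pcl.
  apply/negP => /= xy; have := twin _ _ xP yP xy => /twin_repr_eq.
  rewrite !repr_id ?(valP x) ?(valP y) // => e.
  by move: xy; rewrite /induced_adj e adj_irr.
- have cC : c \in C by rewrite inE connect0.
  exists (f (exist _ c cC)) => z; have [x <-] := f_surj z => nfx.
  have := valP x; rewrite inE => /(core_connect Pc) xc.
  rewrite /= /induced_adj /= adj_clnbh -val_eqE eq_sym in nfx *.
  by rewrite nfx clnbh_twin_repr clnbh_sym clnbh_twin_repr clnbh_sym.
apply: (@blowup_clique_subst _ _ _ _ _ f) => // [x y|x y _]; last by rewrite inE.
by rewrite /= /induced_adj adj_twin_repr -!val_eqE.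
Qed.

(** The core is the preimage of the clique enlarged by [u], with a preimage of [u] as center.
    Adjacent vertices outside it lie in one fiber, the rest of [S] being stable, so they are true
    twins. *)
Lemma split_component_core (C : {set V}) (U : finType) (S : sgraph U) (u : U) :
    (forall D, big_component G D -> D = C) ->
    is_split S -> universal S u ->
    obtained_by_clique_substitution (induced G C) S ->
  exists P c, clique_core G P c.
Proof.
move=> uniqC [K0 [K0cl K0st]] uS /clique_subst_blowup[f f_surj fS].
pose K := u |: K0.
have Kcl : clique S K.
  move=> x y; rewrite !inE => /predU1P[->|xK] /predU1P[->|yK] nxy.
  - by rewrite eqxx in nxy.
  - by apply: uS; rewrite eq_sym.
  - by rewrite adj_sym; apply: uS.
  - exact: K0cl.
have Kst : stable S (~: K).
  move=> x y; rewrite !inE !negb_or => /andP[_ ?] /andP[_ ?].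
  by apply: K0st; rewrite inE.
(* The component of an edge is big, so it is [C]. *)
have GC x y : G x y -> x \in C /\ y \in C.
  by move=> xy; rewrite -(uniqC _ (adj_big_component xy)) !inE connect0 connect1.
pose P := [set val x | x : {x | x \in C} & f x \in K].
have PE (x : {x | x \in C}) : (val x \in P) = (f x \in K).
  apply/imsetP/idP => [[y]|xK]; last by exists x; rewrite // in_set.
  by rewrite in_set => yK /val_inj->.
have GS (x y : {x | x \in C}) :
    G (val x) (val y) = (x != y) && ((f x == f y) || S (f x) (f y)) := fS x y.
have [c fc] := f_surj u.
exists P, (val c); split.
- move=> _ _ /imsetP[x xK ->] /imsetP[y yK ->]; rewrite in_set in xK; rewrite in_set in yK.
  rewrite val_eqE GS => -> /=; have [//|nf] /= := eqVneq.
  exact: Kcl.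
- by rewrite PE fc !inE eqxx.
- move=> x y /GC[xC _]; rewrite in_clnbh -[x]/(val (exist (fun x => x \in C) x xC)).
  rewrite GS val_eqE eq_sym; have [//|_] /= := eqVneq.
  rewrite fc eq_sym; have [//|nf] /= := eqVneq; exact: uS.
move=> x y xP yP xy; have [xC yC] := GC _ _ xy.
pose x' : {x | x \in C} := exist _ x xC; pose y' : {x | x \in C} := exist _ y yC.
have fxy : f x' = f y'.
  have nS : ~~ S (f x') (f y') by apply: Kst; rewrite inE -PE.
  move: xy; rewrite -[x]/(val x') -[y]/(val y') GS (negPf nS) orbF.
  by case/andP=> _ /eqP.
apply/setP=> z; rewrite !in_clnbh.
have [zC|zC] := boolP (z \in C); last first.
  have nG t : G t z = false by apply: contraNF zC => /GC[].
  rewrite !nG !orbF; transitivity false; first by apply: contraNF zC => /eqP->.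
  by apply/esym; apply: contraNF zC => /eqP->.
pose z' : {x | x \in C} := exist _ z zC.
rewrite -[z]/(val z') -[x]/(val x') -[y]/(val y') !GS !val_eqE fxy !(eq_sym z').
have [<-|_] /= := eqVneq x' z'; first by rewrite -fxy eqxx; case: (_ == _).
by have [<-|_] //= := eqVneq y' z'; rewrite eqxx.
Qed.

Lemma edgeless_core (c : V) :
  (forall x y, ~~ G x y) -> clique_core G [set c] c.
Proof.
move=> G0; split=> [x y /set1P-> /set1P-> |||]; rewrite ?eqxx ?inE //.
  by move=> x y; rewrite (negPf (G0 x y)).
by move=> x y _ _; rewrite (negPf (G0 x y)).
Qed.

End CoreStructure.

Theorem theorem3 (V : finType) (G : sgraph V) (V_nonempty : 0 < #|V|) :
  (exists (W : finType) (E : V -> W -> bool),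
     star_biconvex E /\ forall x y : V, G x y = half_square E x y)
  <->
  ((forall C D : {set V}, big_component G C -> big_component G D -> C = D) /\
   (forall C : {set V}, big_component G C ->
      exists (U : finType) (S : sgraph U),
        is_split S /\ (exists u : U, universal S u) /\
        obtained_by_clique_substitution (induced G C) S)).
Proof.
split=> [[W [E [bicE GE]]]|[uniqC splitC]].
  have [P [c Pc]] := half_square_core bicE GE; split=> [C D bC bD|C bC].
    by rewrite (core_big_component Pc bC) (core_big_component Pc bD).
  by rewrite (core_big_component Pc bC); apply: core_split_component Pc.
have [P [c Pc]] : exists P c, clique_core G P c.
  have [/existsP[x /existsP[y xy]]|G0] := boolP [exists x, exists y, G x y].
    have bC := adj_big_component xy.
    have [U [S [splitS [[u uS] substS]]]] := splitC _ bC.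
    by apply: split_component_core splitS uS substS => D bD; apply: uniqC.
  (* Without edges any single vertex is a core; nonemptiness provides one. *)
  have /card_gt0P[c _] := V_nonempty.
  exists [set c], c; apply: edgeless_core => x y; apply: contra G0 => xy.
  by apply/existsP; exists x; apply/existsP; exists y.
exists (option {set V}), (core_edge G P c); split; first exact: core_star_biconvex.
exact: core_half_square.
Qed.
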